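(* Let $A\in\mathbb{M}_n(\mathbb{C})$ be a partial isometry. Then $$AA^*(A^{D,*})^2A=A^D=A^DA^*A.$$ Moreover, if $k=\mathrm{ind}(A)$, then $A^kA^DA^*A^2=A^k$ and $A^kA^*A^2=A^{k+1}$.
   Context: $\mathbb{M}_n(\mathbb{C})$ is the algebra of $n\times n$ complex matrices; $^*$ is conjugate transpose; $A^0=I$. $A$ is a partial isometry if $A^\dagger=A^*$ (Moore-Penrose inverse equals conjugate transpose), equivalently $AA^*A=A$. The index $\mathrm{ind}(A)$ is the smallest integer $k\ge 0$ with $\mathrm{rank}(A^k)=\mathrm{rank}(A^{k+1})$. With $k=\mathrm{ind}(A)$, the Drazin inverse $A^D$ is the unique $X$ with $AX=XA$, $XAX=X$, $XA^{k+1}=A^k$. The Drazin-Star matrix of $A$ is $A^{D,*}=A^DAA^*$. *)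

(* Defs.v *)
From mathcomp Require Import all_boot all_order all_algebra.
From mathcomp Require Import sesquilinear spectral.
From mathcomp Require Import complex.
From mathcomp Require Import reals.

Set Implicit Arguments.
Unset Strict Implicit.
Unset Printing Implicit Defensive.

Import Order.TTheory GRing.Theory Num.Theory.
Local Open Scope ring_scope.
Local Open Scope sesquilinear_scope.

(* [M ^t*] is the conjugate transpose of [M]. *)

Section MoorePenrose.
Variable C : numClosedFieldType.

(* The four Penrose equations. *)
Definition is_moore_penrose m n (A : 'M[C]_(m, n)) : pred 'M[C]_(n, m) :=
  fun X => [&& A *m X *m A == A, X *m A *m X == X,
               (A *m X)^t* == A *m X & (X *m A)^t* == X *m A].

Lemma trmxC_mul m n p (A : 'M[C]_(m, n)) (B : 'M[C]_(n, p)) :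
  (A *m B)^t* = B^t* *m A^t*.
Proof. by rewrite trmx_mul map_mxM. Qed.

Lemma gram_unit m n (F : 'M[C]_(m, n)) : row_free F -> F *m F^t* \in unitmx.
Proof.
move=> Ffree; rewrite -row_free_unit; apply: inj_row_free => v vFF.
apply/eqP; rewrite -(mulmx_free_eq0 v Ffree); apply: contraT => vF_neq0.
have := dotmx_is_dotmx vF_neq0.
by rewrite dotmxE trmxC_mul mulmxA -(mulmxA v) vFF mul0mx mxE ltxx.
Qed.

Lemma invmxC n (A : 'M[C]_n) : (invmx A)^t* = invmx (A^t*).
Proof. by rewrite trmx_inv map_invmx. Qed.

Lemma moore_penrose_exists m n (A : 'M[C]_(m, n)) :
  exists X, is_moore_penrose A X.
Proof.
have [r [K [F [AE Ffree Kfull]]]] : exists r (K : 'M_(m, r)) (F : 'M_(r, n)),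
    [/\ A = K *m F, row_free F & row_full K].
  exists (\rank A), (col_base A), (row_base A).
  by rewrite mulmx_base row_base_free col_base_full.
have uF : F *m F^t* \in unitmx by apply: gram_unit.
have uK : K^t* *m K \in unitmx.
  rewrite -{2}[K]trmxCK; apply: gram_unit.
  by rewrite /row_free mxrank_map mxrank_tr; exact: Kfull.
pose P := invmx (F *m F^t*); pose Q := invmx (K^t* *m K).
have PC : P^t* = P by rewrite invmxC trmxC_mul trmxCK.
have QC : Q^t* = Q by rewrite invmxC trmxC_mul trmxCK.
pose X := F^t* *m P *m Q *m K^t*.
have AX : A *m X = K *m Q *m K^t*.
  by rewrite AE /X !mulmxA -(mulmxA K F) mulmxK.
have XA : X *m A = F^t* *m P *m F.
  by rewrite AE /X !mulmxA -(mulmxA _ (K^t*) K) mulmxKV.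
exists X; apply/and4P; split; apply/eqP.
- by rewrite AX {1}AE !mulmxA -(mulmxA _ (K^t*) K) mulmxKV -?AE.
- by rewrite XA {1}/X !mulmxA -(mulmxA _ F (F^t*)) mulmxKV.
- by rewrite AX !trmxC_mul trmxCK QC mulmxA.
- by rewrite XA !trmxC_mul trmxCK PC mulmxA.
Qed.

Definition moore_penrose m n (A : 'M[C]_(m, n)) : 'M[C]_(n, m) :=
  xchoose (moore_penrose_exists A).

Lemma moore_penroseP m n (A : 'M[C]_(m, n)) :
  is_moore_penrose A (moore_penrose A).
Proof. exact: xchooseP. Qed.

Lemma is_moore_penrose_uniq m n (A : 'M[C]_(m, n)) X Y :
  is_moore_penrose A X -> is_moore_penrose A Y -> X = Y.
Proof.
case/and4P=> /eqP AXA /eqP XAX /eqP AXC /eqP XAC.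
case/and4P=> /eqP AYA /eqP YAY /eqP AYC /eqP YAC.
have AXY : A *m X = A *m Y.
  by rewrite -AXC -{1}AYA -(mulmxA (A *m Y)) trmxC_mul AXC AYC mulmxA AXA.
have XYA : X *m A = Y *m A.
  rewrite -XAC -{1}AYA -(mulmxA A) mulmxA trmxC_mul XAC YAC.
  by rewrite -mulmxA (mulmxA A) AXA.
by rewrite -XAX XYA -mulmxA AXY mulmxA.
Qed.

Definition partial_isometry n (A : 'M[C]_n) : Prop := moore_penrose A = A^t*.

End MoorePenrose.

Section Drazin.
Variables (F : fieldType) (n : nat).
Implicit Type A : 'M[F]_n.

Lemma mxindex_exists A : exists k, \rank (A ^+ k) == \rank (A ^+ k.+1).
Proof.
have rle k : (\rank (A ^+ k.+1) <= \rank (A ^+ k))%N.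
  by rewrite exprS -mulmxE mxrankM_maxr.
suff main r k : (\rank (A ^+ k) <= r)%N ->
    exists k, \rank (A ^+ k) == \rank (A ^+ k.+1).
  by apply: (main n 0%N); apply: rank_leq_row.
elim: r k => [|r IHr] k rk.
  by exists k; rewrite eqn_leq rle andbT (leq_trans rk).
have [/eqP eq_rk|neq] := eqVneq (\rank (A ^+ k)) (\rank (A ^+ k.+1)).
  by exists k.
by apply: (IHr k.+1); rewrite -ltnS (leq_trans _ rk)// ltn_neqAle eq_sym neq rle.
Qed.

Definition mxindex A : nat := ex_minn (mxindex_exists A).

Definition is_drazin A : pred 'M[F]_n :=
  fun X => [&& A *m X == X *m A, X *m A *m X == X &
               X *m A ^+ (mxindex A).+1 == A ^+ mxindex A].

Lemma drazin_exists A : exists X, is_drazin A X.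
Proof.
rewrite /is_drazin /mxindex; case: ex_minnP => k /eqP rkE _.
have [Y AY] : exists Y, A ^+ k = Y * A ^+ k.+1.
  apply/submxP; rewrite -(geq_leqif (mxrank_leqif_sup _)) ?rkE//.
  by rewrite exprS -mulmxE submxMl.
have [Z AZ] : exists Z, A ^+ k = A ^+ k.+1 * Z.
  suff /submxP[Z] : ((A ^+ k)^T <= (A ^+ k.+1)^T)%MS.
    by move/(congr1 trmx); rewrite trmx_mul !trmxK => ->; exists Z^T.
  rewrite -(geq_leqif (mxrank_leqif_sup _)) ?mxrank_tr ?rkE//.
  by rewrite exprSr -mulmxE trmx_mul submxMl.
have AYi j : Y ^+ j * A ^+ (k + j) = A ^+ k.
  elim: j => [|j IHj]; first by rewrite mul1r addn0.
  by rewrite exprSr addnS -addSn exprD mulrA -(mulrA _ Y) -AY -mulrA -exprD.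
have AZi j : A ^+ (j + k) * Z ^+ j = A ^+ k.
  elim: j => [|j IHj]; first by rewrite mulr1.
  by rewrite exprS addSnnS exprD mulrA -(mulrA _ _ Z) -AZ -exprD.
have YkE : Y ^+ k * A ^+ k = A ^+ k * Z ^+ k.
  by rewrite -[in LHS](AZi k) mulrA AYi.
pose X := A ^+ k * Z ^+ k.+1.
have XE : X = Y ^+ k.+1 * A ^+ k.
  by rewrite /X -[in RHS](AZi k.+1) mulrA addnC AYi.
have AX : A * X = A ^+ k * Z ^+ k.
  by rewrite /X mulrA -exprS (exprS Z) mulrA -AZ.
have XA : X * A = A ^+ k * Z ^+ k.
  by rewrite XE -mulrA -exprSr (exprSr Y) -mulrA -AY YkE.
exists X; apply/and3P; split; apply/eqP; rewrite mulmxE.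
- by rewrite AX XA.
- by rewrite XA -YkE /X mulrA -(mulrA (Y ^+ k)) -exprD AYi.
- by rewrite XE -mulrA -exprD -addSnnS addnC AYi.
Qed.

Definition drazin A : 'M[F]_n := xchoose (drazin_exists A).

Lemma drazinP A : is_drazin A (drazin A).
Proof. exact: xchooseP. Qed.

Lemma is_drazin_uniq A X Y : is_drazin A X -> is_drazin A Y -> X = Y.
Proof.
rewrite /is_drazin !mulmxE; set k := mxindex A.
case/and3P=> /eqP AXC /eqP XAX /eqP XAk /and3P[/eqP AYC /eqP YAY /eqP YAk].
have Xj j : X ^+ j.+1 * A ^+ j = X.
  elim: j => [|j IHj]; first by rewrite mulr1 expr1.
  by rewrite (exprS X) (exprSr A) mulrA -(mulrA X) IHj -mulrA -AXC mulrA.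
have Yj j : A ^+ j * Y ^+ j.+1 = Y.
  elim: j => [|j IHj]; first by rewrite mul1r expr1.
  by rewrite (exprS A) (exprSr Y) mulrA -(mulrA A) IHj AYC YAY.
have {1}<- : X * A * Y = X.
  rewrite -{1}(Xj k) -(mulrA _ _ A) -exprSr -mulrA.
  have -> : A ^+ k.+1 * Y = Y * A ^+ k.+1 by apply: esym; apply: commrX.
  by rewrite YAk Xj.
by rewrite -{1}(Yj k) -mulrA (mulrA A) -exprS mulrA XAk Yj.
Qed.

End Drazin.

Definition drazin_star (C : numClosedFieldType) n (A : 'M[C]_n) : 'M[C]_n :=
  drazin A *m A *m A^t*.

(* Main.v *)
(* As [A A^* A = A] and the Drazin inverse [D] satisfies
   [D = A D^2 = D^2 A], any occurrence of [A^*] next to [D] in the four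
   identities can be completed to [A A^* A] by borrowing a factor [A] from
   [D]; hence [A A^* D = D = D A^* A].  Likewise [A^k = A^k D A] supplies the
   missing factor when [A^*] follows [A^k]. *)

Require Import Defs.
From mathcomp Require Import all_boot all_order all_algebra.
From mathcomp Require Import sesquilinear spectral.
From mathcomp Require Import complex.
From mathcomp Require Import reals.
Import Order.TTheory GRing.Theory Num.Theory.
Local Open Scope ring_scope.
Local Open Scope complex_scope.
Local Open Scope sesquilinear_scope.

Lemma partial_isometryP {C : numClosedFieldType} {n} {A : 'M[C]_n} :
  partial_isometry A -> A * A^t* * A = A.
Proof. by move=> <-; case/and4P: (moore_penroseP A) => /eqP. Qed.

Section DrazinTheory.
Context {F : fieldType} {n : nat}.
Implicit Types A S : 'M[F]_n.

Lemma drazinC A : A * drazin A = drazin A * A.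
Proof. by case/and3P: (drazinP A) => /eqP. Qed.

Lemma drazinK A : drazin A * A * drazin A = drazin A.
Proof. by case/and3P: (drazinP A) => _ /eqP. Qed.

(** As [D] commutes with [A], this is the defining equation [D A^(k+1) = A^k]. *)
Lemma expr_mxindex_drazin A :
  A ^+ mxindex A * drazin A * A = A ^+ mxindex A.
Proof.
have /and3P[_ _ /eqP DAk] := drazinP A.
rewrite -mulrA -drazinC mulrA -exprSr -[RHS]DAk.
exact/commr_sym/commrX/commr_sym/drazinC.
Qed.

(** [S] is any inner inverse; [D = A D D] supplies the right-hand [A]. *)
Lemma mul_inner_drazin {A S} : A * S * A = A -> A * S * drazin A = drazin A.
Proof. by move=> ASA; rewrite -(drazinK A) -drazinC !mulrA ASA. Qed.

Lemma drazin_mul_inner {A S} : A * S * A = A -> drazin A * S * A = drazin A.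
Proof.
move=> ASA; rewrite -{1}(drazinK A) -(mulrA _ A) drazinC mulrA.
by rewrite -!mulrA (mulrA A) ASA -drazinC mulrA drazinK.
Qed.

End DrazinTheory.

Theorem theorem4p1 (R : realType) (n : nat) (A : 'M[R[i]]_n)
    (hA : partial_isometry A) :
  (A *m A^t* *m drazin_star A ^+ 2 *m A = drazin A /\
   drazin A = drazin A *m A^t* *m A) /\
  (forall k : nat, k = mxindex A ->
     A ^+ k *m drazin A *m A^t* *m A ^+ 2 = A ^+ k /\
     A ^+ k *m A^t* *m A ^+ 2 = A ^+ k.+1).
Proof.
have ASA := partial_isometryP hA.
have ASD := mul_inner_drazin ASA.
have DSA := drazin_mul_inner ASA.
rewrite /drazin_star !mulmxE; split.
  split; last by rewrite DSA.
  (* Each of the two blocks [A A^* D] collapses to [D], leaving [D D A A^* A = D D A]. *)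
  rewrite expr2 !mulrA ASD -2!(mulrA (drazin A)) ASD.
  by rewrite -2!(mulrA (_ * drazin A)) ASA -mulrA -drazinC mulrA drazinK.
move=> k ->; have AkDA := expr_mxindex_drazin A.
split; rewrite expr2 mulrA.
  (* One factor of [A^2] is absorbed in [D A^* A = D]; the other closes [A^k D A]. *)
  by rewrite -2!(mulrA (A ^+ _)) DSA AkDA.
by rewrite -{1}AkDA -2!(mulrA (_ * drazin A)) ASA AkDA exprSr.
Qed.
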